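(* Define $a_0=1$ and $a_{n+1}=C_n-a_n$ for all $n\ge0$, where $C_n=\frac{1}{n+1}\binom{2n}{n}$ is the $n$th Catalan number. Then for all $n\geq 0$ and $\sigma\in\{213,312\}$, the number $d_n(\sigma)$ of desarrangements of length $n$ avoiding $\sigma$ equals $a_n$.
   Context: Permutations are in one-line notation; $\mathfrak{S}_0$ consists of the empty permutation, which is considered a desarrangement. An index $i\in[n-1]$ is a descent of $\pi\in\mathfrak{S}_n$ if $\pi_i>\pi_{i+1}$; $i\in[n]$ is an ascent if it is not a descent (so $n$ is always an ascent). A desarrangement is a permutation whose first ascent is even. $d_n(\Pi)$ is the number of desarrangements in $\mathfrak{S}_n$ avoiding every pattern in $\Pi$ ($\pi$ avoids $\sigma$ if no subsequence of $\pi$ has the same relative order as $\sigma$). *)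

(* Defs.v *)
From mathcomp Require Import all_boot all_order all_algebra all_fingroup.

Set Implicit Arguments.
Unset Strict Implicit.
Unset Printing Implicit Defensive.

(* Positions and values are numbered from 1, as in the one-line notation
   pi_1 ... pi_n. *)
Definition oneline (n : nat) (pi : 'S_n) : seq nat :=
  [seq (val (pi i)).+1 | i <- enum 'I_n].

(* The entry pi_i, for 1 <= i <= n. *)
Definition entry (n : nat) (pi : 'S_n) (i : nat) : nat :=
  nth 0 (oneline pi) i.-1.

Definition is_descent (n : nat) (pi : 'S_n) (i : nat) : bool :=
  (1 <= i < n) && (entry pi i.+1 < entry pi i).

Definition is_ascent (n : nat) (pi : 'S_n) (i : nat) : bool :=
  (1 <= i <= n) && ~~ is_descent pi i.

Definition is_first_ascent (n : nat) (pi : 'S_n) (i : nat) : bool :=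
  is_ascent pi i && [forall j : 'I_n.+1, is_ascent pi j ==> (i <= j)].

(* The empty permutation has no ascent; it is a desarrangement by convention. *)
Definition desarrangement (n : nat) (pi : 'S_n) : bool :=
  (n == 0) || [exists i : 'I_n.+1, is_first_ascent pi i && ~~ odd i].

(* A pattern is given by its one-line word; an occurrence in pi is a
   subsequence of pi, i.e. a strictly increasing choice f of positions
   (here 0-based), in the same relative order as the pattern. *)
Definition occurrence (n : nat) (pi : 'S_n) (sigma : seq nat)
    (f : {ffun 'I_(size sigma) -> 'I_n}) : bool :=
  [forall i : 'I_(size sigma), forall j : 'I_(size sigma),
     (i < j) ==> (f i < f j)] &&
  [forall i : 'I_(size sigma), forall j : 'I_(size sigma),
     (nth 0 sigma i < nth 0 sigma j) == (pi (f i) < pi (f j))].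

Definition avoids (n : nat) (pi : 'S_n) (sigma : seq nat) : bool :=
  ~~ [exists f : {ffun 'I_(size sigma) -> 'I_n}, occurrence pi f].

Definition d (n : nat) (Pi : seq (seq nat)) : nat :=
  #|[set pi : 'S_n | desarrangement pi & all (avoids pi) Pi]|.

(* The division is exact, see catalanE. *)
Definition catalan (n : nat) : nat := 'C(2 * n, n) %/ n.+1.

Lemma catalanE (n : nat) : n.+1 * catalan n = 'C(2 * n, n).
Proof.
rewrite mulnC divnK //.
have E : n.+1 * 'C(2 * n, n.+1) = n * 'C(2 * n, n).
  by rewrite mul_bin_left mul2n -addnn addnK.
have E2 : 'C(2 * n, n) = n.+1 * 'C(2 * n, n) - n.+1 * 'C(2 * n, n.+1).
  by rewrite E mulSn addnK.
by rewrite E2 -mulnBr dvdn_mulr.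
Qed.

Fixpoint a (n : nat) : int :=
  if n is m.+1 then ((catalan m)%:Z - a m)%R else 1%R.

(* Main.v *)
(** Split a word avoiding 312 (or 213) at its minimum [m] as [A ++ m :: B].  The
    parts are arbitrary avoiding words, subject to all of [A] lying below
    (respectively above) all of [B].  Since [m] is smaller than both neighbours,
    the first ascent of the whole word is [|A| + 1] when [A] is decreasing, and
    that of [A] otherwise.  Exactly one [A] of each length [k] is decreasing, so
    in both cases
      [d_{n+1} = \sum_(k <= n) C_{n-k} (d_k - (-1)^k)].
    The sequence [b_k = a_k - (-1)^k] satisfies [b_0 = 0] and
    [b_{k+1} + b_k = C_k], so by the Catalan convolution [a] obeys the same
    recurrence. *)
Require Import Defs.
From mathcomp Require Import all_boot all_order all_algebra all_fingroup.
From mathcomp Require Import zify ring.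

Set Implicit Arguments.
Unset Strict Implicit.
Unset Printing Implicit Defensive.

Lemma catalan0 : catalan 0 = 1. Proof. by []. Qed.

Lemma catalanS n : n.+2 * catalan n.+1 = (4 * n + 2) * catalan n.
Proof.
have E1 : 'C(2 * n.+1, n.+1) * n.+1 = 2 * 'C((2 * n).+1, n) * n.+1.
  have -> : 2 * n.+1 = (2 * n).+2 by lia.
  have := mul_bin_diag (2 * n).+2 n; have := mul_bin_left (2 * n).+1 n.
  rewrite binS /=.
  have -> : (2 * n).+1 - n = n.+1 by lia.
  by nia.
have E2 : 'C((2 * n).+1, n) * n.+1 = (2 * n).+1 * 'C(2 * n, n).
  have := mul_bin_down (2 * n).+1 n; rewrite /=.
  have -> : (2 * n).+1 - n = n.+1 by lia.
  by nia.
have := catalanE n; have := catalanE n.+1 => H1 H0.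
apply/eqP; rewrite -(@eqn_pmul2r n.+1) //; apply/eqP.
by rewrite H1 E1 -mulnA E2 -H0; lia.
Qed.

(* Weighting the convolution by the index [k] turns the first order recurrence
   of the Catalan numbers into one for the convolution itself. *)
Lemma catalan_convolution n :
  \sum_(k < n.+1) catalan k * catalan (n - k) = catalan n.+1.
Proof.
pose S n := \sum_(k < n.+1) catalan k * catalan (n - k).
pose T n := \sum_(k < n.+1) k * (catalan k * catalan (n - k)).
have TS i : 2 * T i = i * S i.
  have TE : T i = \sum_(k < i.+1) (i - k) * (catalan k * catalan (i - k)).
    rewrite /T (reindex_inj rev_ord_inj) /=; apply: eq_bigr => k _.
    have lt_ki := ltn_ord k.
    by rewrite subSS subKn // [catalan (i - k) * _]mulnC.
  rewrite mul2n -addnn {2}TE /S big_distrr -big_split /=; apply: eq_bigr => k _.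
  by rewrite -mulnDl subnKC // -ltnS.
have rec i : (i + 3) * S i.+1 = (4 * i + 4) * S i + 2 * catalan i.+1.
  have E : T i.+1 + S i.+1 = catalan i.+1 + (4 * T i + 2 * S i).
    rewrite /T /S -big_split [LHS]big_ord_recl /= mul0n add0n mul1n subn0.
    congr (_ + _); rewrite !big_distrr -big_split; apply: eq_bigr => k _ /=.
    rewrite /bump /= add1n subSS; have := catalanS k; nia.
  have := TS i; have := TS i.+1; nia.
elim: n => [|n IHn]; first by rewrite big_ord_recl big_ord0.
have := rec n; rewrite /S IHn; have := catalanS n.+1; nia.
Qed.

(* [b = true] encodes the pattern 312 and [b = false] the pattern 213. *)
Definition order_like (b : bool) (x y z : nat) : bool :=
  [&& y < x, y < z & if b then z < x else x < z].

Fixpoint word_avoids (b : bool) (w : seq nat) : bool :=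
  if w is x :: v then
    word_avoids b v && pairwise (fun y z => ~~ order_like b x y z) v
  else true.

Definition weakly_ordered (b : bool) (x z : nat) : bool :=
  if b then x <= z else z <= x.

Lemma word_avoidsP b w :
  reflect (forall i j k, i < j -> j < k -> k < size w ->
             ~~ order_like b (nth 0 w i) (nth 0 w j) (nth 0 w k))
          (word_avoids b w).
Proof.
elim: w => [|x w IHw] /=; first by constructor=> i j k.
apply: (iffP andP) => [[/IHw Hw /(pairwiseP 0) Hx] [|i] [|j] [|k] //= ij jk kw|H].
- by apply: Hx => //; rewrite inE; lia.
- exact: Hw.
split; first by apply/IHw => i j k ij jk kw; apply: (H i.+1 j.+1 k.+1).
apply/(pairwiseP 0) => j k; rewrite !inE => jw kw jk.
exact: (H 0 j.+1 k.+1).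
Qed.

Lemma word_avoids_cat_min b m A B :
  all (ltn m) A -> all (ltn m) B ->
  word_avoids b (A ++ m :: B) =
  [&& word_avoids b A, word_avoids b B & allrel (weakly_ordered b) A B].
Proof.
move=> + mB; elim: A => [_|x A IHA /= /andP[mx mA]] /=.
  rewrite allrel0l andbT; apply: andb_idr => _.
  apply/(pairwiseP 0) => j k; rewrite !inE => jB kB _.
  have /= := allP mB _ (mem_nth 0 jB); rewrite /order_like; lia.
rewrite IHA // allrel_consl pairwise_cat /=.
have -> : all (fun z => ~~ order_like b x m z) B = all (weakly_ordered b x) B.
  apply: eq_in_all => z /(allP mB) /=.
  by rewrite /order_like /weakly_ordered; case: b {IHA}; lia.
case: (boolP (all _ B)) => [/allP xB|_]; last by rewrite ?(andbF, andFb).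
have notocc y z : z \in B -> ~~ order_like b x y z.
  by move=> /xB; rewrite /order_like /weakly_ordered; case: b {IHA xB}; lia.
have -> : allrel (fun y z => ~~ order_like b x y z) A (m :: B).
  apply/allrelP => y z yA; rewrite inE => /predU1P[->|/notocc //].
  by have /= := allP mA _ yA; rewrite /order_like; lia.
have -> : pairwise (fun y z => ~~ order_like b x y z) B.
  by apply/(pairwiseP 0) => j k; rewrite !inE => jB kB _; apply/notocc/mem_nth.
rewrite /= !andbT; case: pairwise; by rewrite ?andbT ?andbF.
Qed.

Fixpoint first_ascent (w : seq nat) : nat :=
  if w is x :: v then
    (if v is y :: _ then if y < x then first_ascent v else 0 else 0).+1
  else 0.

Lemma first_ascent_cons2 x y w :
  first_ascent [:: x, y & w] = (if y < x then first_ascent (y :: w) else 0).+1.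
Proof. by []. Qed.

Lemma first_ascent_le w : first_ascent w <= size w.
Proof.
elim: w => [|x [|y w] IHw] //=; rewrite ltnS.
by case: ifP.
Qed.

Lemma first_ascent_gt0 w : (0 < first_ascent w) = (0 < size w).
Proof. by case: w. Qed.

Lemma first_ascent_descent w i :
  i.+1 < first_ascent w -> nth 0 w i.+1 < nth 0 w i.
Proof.
elim: w i => [|x [|y w] IHw] i //.
rewrite /first_ascent -/first_ascent; case: ifP => // yx.
by case: i => [|i] // /IHw.
Qed.

Lemma first_ascent_ascent w :
  0 < first_ascent w < size w ->
  nth 0 w (first_ascent w).-1 <= nth 0 w (first_ascent w).
Proof.
elim: w => [|x [|y w] IHw] //.
rewrite first_ascent_cons2.
case: (ltnP y x) => [yx|/= yx _ //]; rewrite ltnS => /andP[_ H].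
rewrite -[nth _ _ _.+1]/(nth 0 (y :: w) (first_ascent (y :: w))).
by apply: IHw; rewrite first_ascent_gt0 -ltnS.
Qed.

Lemma first_ascent_cat_min m A B : all (ltn m) A -> all (ltn m) B ->
  first_ascent (A ++ m :: B) =
  if first_ascent A == size A then (size A).+1 else first_ascent A.
Proof.
move=> + mB.
have ascm : first_ascent (m :: B) = 1.
  by case: B mB => [|z B] //= /andP[mz _]; rewrite ltnNge ltnW.
elim: A => [_|x [|y A] IHA] //.
  by rewrite cat1s first_ascent_cons2 ascm /= => /andP[->].
move=> /andP[_ myA]; rewrite !cat_cons !first_ascent_cons2 -cat_cons IHA //.
rewrite -[size [:: x, y & A]]/(size (y :: A)).+1.
case: (y < x) => //; move: (first_ascent _) (size _) => p q.
by rewrite eqSS; case: eqP.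
Qed.

Lemma first_ascent_sorted w :
  (first_ascent w == size w) = sorted (fun x y => y < x) w.
Proof.
elim: w => [|x [|y w] IHw] //; rewrite first_ascent_cons2.
rewrite -[size [:: x, y & w]]/(size (y :: w)).+1.
rewrite -[RHS]/((y < x) && sorted (fun x y => y < x) (y :: w)) -IHw eqSS.
by case: (y < x).
Qed.

Definition words (b : bool) (m n : nat) : seq (seq nat) :=
  [seq w <- permutations (iota m n) | word_avoids b w].

Lemma mem_words b m n w :
  (w \in words b m n) = word_avoids b w && perm_eq w (iota m n).
Proof. by rewrite mem_filter mem_permutations. Qed.

Lemma words_uniq b m n : uniq (words b m n).
Proof. by rewrite filter_uniq // permutations_uniq. Qed.

Lemma word_size b m n w : w \in words b m n -> size w = n.
Proof. by rewrite mem_words => /andP[_ /perm_size]; rewrite size_iota. Qed.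

Lemma words_ge b m n w : w \in words b m n -> all (leq m) w.
Proof.
rewrite mem_words => /andP[_ /perm_mem E]; apply/allP => x.
by rewrite E mem_iota => /andP[].
Qed.

Lemma perm_cat_iota m A B : allrel leq A B ->
  perm_eq (A ++ B) (iota m (size A + size B)) ->
  perm_eq A (iota m (size A)) /\ perm_eq B (iota (m + size A) (size B)).
Proof.
move=> leAB permAB.
have : sort leq A ++ sort leq B = iota m (size A + size B).
  apply: (sorted_eq leq_trans anti_leq).
  - rewrite sorted_pairwise; last exact: leq_trans.
    rewrite pairwise_cat -!(sorted_pairwise leq_trans) !(sort_sorted leq_total).
    rewrite !andbT; apply/allrelP => x y; rewrite !mem_sort.
    by move/allrelP: leAB; apply.
  - exact: iota_sorted.
  - by rewrite -(permPr permAB) perm_cat // perm_sort.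
rewrite iotaD => /eqP; rewrite eqseq_cat ?size_sort ?size_iota //.
move=> /andP[/eqP EA /eqP EB].
by rewrite -EA -EB; split; rewrite perm_sym perm_sort.
Qed.

Definition left_min (b : bool) (m l : nat) := if b then m.+1 else m.+1 + l.
Definition right_min (b : bool) (m k : nat) := if b then m.+1 + k else m.+1.

Lemma words_cat_min b m A B k l : size A = k -> size B = l ->
  (A ++ m :: B \in words b m (k + l).+1) =
  (A \in words b (left_min b m l) k) && (B \in words b (right_min b m k) l).
Proof.
move=> sA sB; rewrite !mem_words.
have -> : perm_eq (A ++ m :: B) (iota m (k + l).+1) =
          perm_eq (A ++ B) (iota m.+1 (k + l)).
  by rewrite -[m :: B]cat1s perm_catCA /= perm_cons.
apply/andP/andP => [[avw permw]|[/andP[avA permA] /andP[avB permB]]].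
  have gtm : all (ltn m) (A ++ B).
    by apply/allP => x; rewrite (perm_mem permw) mem_iota => /andP[].
  move: gtm; rewrite all_cat => /andP[mA mB].
  move: avw; rewrite word_avoids_cat_min // => /and3P[-> -> ordAB] /=.
  move: permw ordAB; rewrite -sA -sB /weakly_ordered /left_min /right_min.
  case: b => permw ordAB; first by apply/andP/andP; case: (perm_cat_iota _ permw).
  rewrite perm_catC addnC in permw.
  have ordBA : allrel leq B A by rewrite allrelC.
  by case: (perm_cat_iota ordBA permw) => -> ->.
have mA : all (ltn m) A.
  apply/allP => x; rewrite (perm_mem permA) mem_iota /left_min /=.
  by case: b {avA avB permA permB}; lia.
have mB : all (ltn m) B.
  apply/allP => x; rewrite (perm_mem permB) mem_iota /right_min /=.
  by case: b {avA avB permA permB}; lia.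
rewrite word_avoids_cat_min // avA avB /=; split.
  apply/allrelP => x y; rewrite (perm_mem permA) (perm_mem permB) !mem_iota.
  by rewrite /weakly_ordered /left_min /right_min; case: b {avA avB permA permB}; lia.
move: permA permB; rewrite /left_min /right_min; case: b {avA avB} => permA permB.
  by rewrite iotaD perm_cat.
by rewrite perm_catC addnC iotaD perm_cat.
Qed.

Lemma sum_words b m n (F : seq nat -> nat) :
  \sum_(w <- words b m n.+1) F w =
  \sum_(k < n.+1) \sum_(A <- words b (left_min b m (n - k)) k)
    \sum_(B <- words b (right_min b m k) (n - k)) F (A ++ m :: B).
Proof.
rewrite (partition_big (fun w => inord (index m w) : 'I_n.+1) predT) //=.
apply: eq_bigr => k _; rewrite -big_filter.
have kn : k + (n - k) = n by rewrite subnKC // -ltnS.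
rewrite -(big_allpairs_dep (h := fun A B => A ++ m :: B)); apply: perm_big.
have notinA A : A \in words b (left_min b m (n - k)) k -> m \notin A.
  move=> /words_ge /allP mA; apply/negP => /mA; rewrite /left_min.
  by case: b {mA}; lia.
apply: uniq_perm; first by rewrite filter_uniq ?words_uniq.
  apply: allpairs_uniq; rewrite ?words_uniq // => -[A B] [A' B'] /=.
  case/allpairsP=> -[A1 B1] [/= /word_size sA _ [-> _]].
  case/allpairsP=> -[A2 B2] [/= /word_size sA' _ [-> _]].
  move/eqP; rewrite eqseq_cat ?sA ?sA' // => /andP[/eqP -> /eqP[->]] //.
move=> w; rewrite mem_filter; apply/andP/allpairsP => [[/eqP indw ww]|].
  have mw : m \in w.
    by move: ww; rewrite mem_words => /andP[_ /perm_mem ->]; rewrite mem_iota; lia.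
  have sw := word_size ww.
  have {}indw : index m w = k.
    by rewrite -indw inordK // -sw index_mem.
  exists (take k w, drop k.+1 w) => /=.
  have wE : w = take k w ++ m :: drop k.+1 w.
    by rewrite -{1}(nth_index 0 mw) indw -drop_nth ?cat_take_drop // sw.
  have sA : size (take k w) = k by rewrite size_takel // sw ltnW.
  have sB : size (drop k.+1 w) = n - k by rewrite size_drop sw.
  have := words_cat_min b m sA sB; rewrite -wE kn ww => /esym/andP[-> ->].
  by split.
case=> -[A B] [/= wA wB ->].
have sA := word_size wA; have sB := word_size wB.
split; last by rewrite -{1}kn (words_cat_min _ _ sA sB) wA wB.
rewrite index_cat (negbTE (notinA _ wA)) /= eqxx addn0 sA.
by apply/eqP/val_inj; rewrite /= inordK.
Qed.

Lemma decreasing_word_avoids b w :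
  sorted (fun x y => y < x) w -> word_avoids b w.
Proof.
rewrite sorted_pairwise; last by move=> x y z yx zx; apply: ltn_trans zx yx.
elim: w => [|x w IHw] //= /andP[_ decw]; rewrite IHw //=.
by apply: sub_pairwise decw => y z zy; rewrite /order_like; lia.
Qed.

Lemma count_decreasing_words b m n :
  count (fun w => first_ascent w == size w) (words b m n) = 1.
Proof.
have dec : sorted (fun x y => y < x) (rev (iota m n)).
  by rewrite rev_sorted iota_ltn_sorted.
rewrite (@eq_in_count _ _ (pred1 (rev (iota m n)))).
  rewrite count_uniq_mem ?words_uniq // mem_words.
  by rewrite decreasing_word_avoids // perm_rev perm_refl.
move=> w; rewrite mem_words first_ascent_sorted => /andP[_ permw] /=.
apply/idP/eqP => [decw|-> //].
apply: (irr_sorted_eq _ _ decw dec).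
- by move=> x y z yx zx; apply: ltn_trans zx yx.
- by move=> x; rewrite /= ltnn.
- by move=> x; rewrite mem_rev (perm_mem permw).
Qed.

Lemma sum_const_seq (T : Type) (s : seq T) c : \sum_(x <- s) c = size s * c.
Proof. by rewrite -sum1_size big_distrl; apply: eq_bigr => i _ /=; rewrite mul1n. Qed.

Lemma size_words b m n : size (words b m n) = catalan n.
Proof.
elim/ltn_ind: n m => -[_ m|n IHn m]; first by rewrite catalan0.
rewrite -catalan_convolution -sum1_size sum_words; apply: eq_bigr => k _.
have kn := ltn_ord k.
by rewrite sum_const_seq sum1_size !IHn //; lia.
Qed.

Lemma desarrangement_words_step b m n :
  \sum_(w <- words b m n.+1) ~~ odd (first_ascent w) =
  \sum_(k < n.+1) catalan (n - k) *
     \sum_(A <- words b (left_min b m (n - k)) k)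
        (if first_ascent A == size A then odd k else ~~ odd (first_ascent A)).
Proof.
rewrite sum_words; apply: eq_bigr => k _; rewrite big_distrr /=.
apply: eq_big_seq => A wA; have sA := word_size wA.
rewrite -(size_words b (right_min b m k)) -sum_const_seq.
apply: eq_big_seq => B wB.
have gtm s j u : j > m -> s \in words b j u -> all (ltn m) s.
  by move=> mj /words_ge; apply: sub_all => x; apply: leq_trans.
have mA : all (ltn m) A.
  by apply: gtm wA; rewrite /left_min; case: (b); lia.
have mB : all (ltn m) B.
  by apply: gtm wB; rewrite /right_min; case: (b); lia.
by rewrite first_ascent_cat_min // sA; case: ifP; rewrite //= negbK.
Qed.

Import GRing.Theory.
Local Open Scope ring_scope.

Lemma a_convolution n :
  a n.+1 = \sum_(k < n.+1) (catalan (n - k))%:Z * (a k - (-1) ^+ k).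
Proof.
elim: n => [|n IHn]; first by rewrite big_ord_recl big_ord0.
rewrite -[LHS]/((catalan n.+1)%:Z - a n.+1) IHn [RHS]big_ord_recl subrr mulr0 add0r.
apply/eqP; rewrite subr_eq -big_split /= -catalan_convolution; apply/eqP.
rewrite (big_morph Posz PoszD (erefl _)); apply: eq_bigr => k _.
rewrite /bump /= add1n subSS PoszM exprS; ring.
Qed.

Lemma desarrangement_words b m n :
  (\sum_(w <- words b m n) ~~ odd (first_ascent w))%N%:Z = a n.
Proof.
elim/ltn_ind: n m => -[_ m|n IHn m].
  by rewrite (_ : words b m 0 = [:: [::]]) ?big_seq1 //; case: b.
rewrite desarrangement_words_step a_convolution.
rewrite (big_morph Posz PoszD (erefl _)); apply: eq_bigr => k _.
rewrite PoszM; congr (_ * _); set lo := left_min _ _ _.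
rewrite -(IHn k (ltn_ord k) lo).
have : (\sum_(A <- words b lo k)
          (if first_ascent A == size A then odd k else ~~ odd (first_ascent A))
        + ~~ odd k = \sum_(A <- words b lo k) ~~ odd (first_ascent A) + odd k)%N.
  have E c : (c = \sum_(A <- words b lo k) (first_ascent A == size A) * c)%N.
    rewrite -big_distrl /=; have := count_decreasing_words b lo k.
    by rewrite -sum1_count big_mkcond /= => ->; rewrite mul1n.
  rewrite [X in (_ + X = _)%N]E [X in (_ = _ + X)%N]E -!big_split /=.
  apply: eq_big_seq => A /word_size sA.
  by case: eqP => [->|_]; rewrite ?sA; lia.
rewrite -signr_odd; case: (odd k); rewrite /= ?expr1 ?expr0; lia.
Qed.

Local Close Scope ring_scope.

Lemma size_oneline n (pi : 'S_n) : size (oneline pi) = n.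
Proof. by rewrite size_map size_enum_ord. Qed.

Lemma nth_oneline n (pi : 'S_n) (i : 'I_n) : nth 0 (oneline pi) i = (pi i).+1.
Proof. by rewrite (nth_map i) ?size_enum_ord // nth_ord_enum. Qed.

Lemma oneline_inj n : injective (@oneline n).
Proof.
move=> pi rho E; apply/permP => i; apply: val_inj => /=.
by have := nth_oneline pi i; rewrite E nth_oneline => -[].
Qed.

Lemma oneline_perm n (pi : 'S_n) : perm_eq (oneline pi) (iota 1 n).
Proof.
have un : uniq (oneline pi).
  by rewrite map_inj_uniq ?enum_uniq // => i j [/val_inj/perm_inj].
have sub : {subset oneline pi <= iota 1 n}.
  by move=> x /mapP[i _ ->]; rewrite mem_iota /= add1n ltnS.
apply: uniq_perm; rewrite ?iota_uniq //.
by have [] // := uniq_min_size un sub; rewrite size_oneline size_iota.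
Qed.

Lemma perm_onelines n :
  perm_eq [seq oneline pi | pi <- enum 'S_n] (permutations (iota 1 n)).
Proof.
have un : uniq [seq oneline pi | pi <- enum 'S_n].
  by rewrite map_inj_uniq ?enum_uniq //; apply: oneline_inj.
have sub : {subset [seq oneline pi | pi <- enum 'S_n] <= permutations (iota 1 n)}.
  by move=> w /mapP[pi _ ->]; rewrite mem_permutations oneline_perm.
apply: uniq_perm; rewrite ?permutations_uniq //.
have [] // := uniq_min_size un sub.
by rewrite size_permutations ?iota_uniq // size_iota size_map -cardE card_Sn.
Qed.

Definition pattern (b : bool) : seq nat := if b then [:: 3; 1; 2] else [:: 2; 1; 3].

Lemma avoids_oneline n (pi : 'S_n) b :
  avoids pi (pattern b) = word_avoids b (oneline pi).
Proof.
have sP : size (pattern b) = 3 by case: b.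
apply/idP/word_avoidsP => [|H].
  move=> /existsPn H i j k ij jk; rewrite size_oneline => kn.
  pose g (t : nat) := nth k [:: i; j; k] t.
  have gn t : g t < n.
    by rewrite /g; case: t => [|[|[|t]]] //=; rewrite ?nth_nil; lia.
  apply/negP => occ; case/negP: (H [ffun t => Ordinal (gn (val t))]).
  have jn : j < n by lia.
  have i_n : i < n by lia.
  move: occ.
  rewrite (nth_oneline pi (Ordinal i_n)) (nth_oneline pi (Ordinal jn)).
  rewrite (nth_oneline pi (Ordinal kn)) /order_like !ltnS => occ.
  have gE0 : Ordinal (gn 0) = Ordinal i_n by apply: val_inj.
  have gE1 : Ordinal (gn 1) = Ordinal jn by apply: val_inj.
  have gE2 : Ordinal (gn 2) = Ordinal kn by apply: val_inj.
  apply/andP; split; apply/'forall_forallP => -[s ls] [t lt]; rewrite !ffunE /=.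
    move: ls lt; rewrite sP /g; case: s => [|[|[|]]] //; case: t => [|[|[|]]] //=; lia.
  move: ls lt; rewrite sP => ls lt; apply/eqP; move: occ.
  case: s ls => [|[|[|s]]] // _; case: t lt => [|[|[|t]]] // _;
    rewrite ?(gE0, gE1, gE2) ?ltnn; case: (b) => /=; lia.
apply/negP => /existsP[f /andP[/'forall_forallP inc /'forall_forallP same]].
case: b H sP f inc same => H _ f inc same;
  pose o0 := @Ordinal 3 0 isT; pose o1 := @Ordinal 3 1 isT;
  pose o2 := @Ordinal 3 2 isT;
  have := H (f o0) (f o1) (f o2) (implyP (inc o0 o1) isT) (implyP (inc o1 o2) isT);
  rewrite size_oneline !nth_oneline /order_like !ltnS => /(_ (ltn_ord _));
  by rewrite -(eqP (same o1 o0)) -(eqP (same o1 o2))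
    -?(eqP (same o2 o0)) -?(eqP (same o0 o2)).
Qed.

Lemma is_first_ascent_oneline n (pi : 'S_n) i : 0 < n ->
  is_first_ascent pi i = (i == first_ascent (oneline pi)).
Proof.
move=> n_gt0; set w := oneline pi; set f := first_ascent w.
have sw : size w = n := size_oneline pi.
have f_gt0 : 0 < f by rewrite first_ascent_gt0 sw.
have f_le : f <= n by rewrite -sw first_ascent_le.
have f_asc : is_ascent pi f.
  rewrite /is_ascent /is_descent f_gt0 f_le /= negb_and -!leqNgt.
  case: ltnP => //= f_lt; apply: first_ascent_ascent.
  by rewrite sw f_gt0.
have f_min j : is_ascent pi j -> f <= j.
  case: j => [|j] // /andP[/andP[_ jn]]; apply: contraR; rewrite -ltnNge => jf.
  by rewrite /is_descent /= (leq_trans jf f_le) first_ascent_descent.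
apply/andP/eqP => [[i_asc /forallP i_min]|->].
  apply/eqP; rewrite eqn_leq f_min // andbT.
  have := i_min (inord f); rewrite inordK // f_asc; exact.
by split=> //; apply/forallP => j; apply/implyP/f_min.
Qed.

Lemma desarrangement_oneline n (pi : 'S_n) :
  desarrangement pi = ~~ odd (first_ascent (oneline pi)).
Proof.
rewrite /desarrangement; case: posnP => [n0|n_gt0] /=.
  by have /size0nil -> := etrans (size_oneline pi) n0.
apply/existsP/idP => [[i]|even_f].
  by rewrite is_first_ascent_oneline // => /andP[/eqP <-].
have f_le : first_ascent (oneline pi) < n.+1.
  by rewrite ltnS (leq_trans (first_ascent_le _)) // size_oneline.
by exists (Ordinal f_le); rewrite is_first_ascent_oneline //= eqxx.
Qed.

Theorem theorem3p10 (n : nat) (sigma : seq nat)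
    (hsigma : sigma \in [:: [:: 2; 1; 3]; [:: 3; 1; 2]]) :
  (d n [:: sigma])%:Z%R = a n.
Proof.
have [b ->] : exists b, sigma = pattern b.
  by move: hsigma; rewrite !inE => /orP[] /eqP ->; [exists false | exists true].
rewrite -(desarrangement_words b 1 n); congr Posz.
rewrite /words big_filter -(perm_big _ (perm_onelines n)) big_map /=.
under [RHS]eq_bigl => pi do rewrite -avoids_oneline.
rewrite /d -sum1_card big_enum_cond /= big_mkcond [RHS]big_mkcond /=.
apply: eq_bigr => pi _; rewrite inE /= andbT desarrangement_oneline andbC.
by case: avoids; case: odd.
Qed.
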